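(* Let $p$ be a prime, let $C$ be a perfectoid field of residue characteristic $p$, let $H_p=\mathbf Z[1/p]$, and let $\mathrm{Pts}_p(C)$ be the set of (local) $C$-points at $p$ of the $\mathbf F_1$-arithmetic curve $(\operatorname{Spec}\mathbf Z)_{\mathbf F_1}$. (i) The elements of $\mathrm{Pts}_p(C)$ correspond precisely to group homomorphisms (by unique extension from $H_p^+$ to $H_p$): $$\mathrm{Pts}_p(C)\simeq\operatorname{Hom}_{\mathrm{Grp}}(H_p,\,1+\mathfrak m_C).$$ (ii) The evaluation map $\beta(\chi)=\chi^\flat:=(\chi(1/p^n))_{n\ge0}$ induces a canonical bijection $$\beta:\mathrm{Pts}_p(C)\xrightarrow{\ \sim\ } D:=1+\mathfrak m_{C^\flat}.$$ (iii) The bijection $\beta$ in (ii) is $\mathbf Q_p^\times$-equivariant.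
   Context: A perfectoid field of residue characteristic $p$ is a field $C$ (of characteristic $0$ or $p$) complete for a nonarchimedean absolute value $|\cdot|$ with residue field of characteristic $p$ (so $|p|<1$), with non-discrete value group, and such that Frobenius is surjective on $\mathcal O_C/p$, where $\mathcal O_C=\{|x|\le 1\}$. Put $\mathfrak m_C=\{|x|<1\}$; $1+\mathfrak m_C$ is a multiplicative group. The tilt $C^\flat$ is the multiplicative monoid of sequences $(x_n)_{n\ge0}$ in $C$ with $x_{n+1}^p=x_n$, a perfectoid field of characteristic $p$ for the addition $(x+y)_n=\lim_m (x_{n+m}+y_{n+m})^{p^m}$ and norm $|x|_{C^\flat}=|x_0|_C$. Let $H_p^+=\{a\in\mathbf Z[1/p] : a\ge0\}$. The stalk of the curve at $p$ is the spherical monoid algebra $\mathbf F_1[T^{H_p^+}]$; a $C$-point at $p$ is a monoid homomorphism $\chi:(H_p^+,+)\to(C,\cdot)$ with $\chi(0)=1$ which is continuous for the $p$-adic topology on $H_p^+\subset\mathbf Q_p$ and the valuation topology on $C$. Actions of $\mathbf Q_p^\times=p^{\mathbf Z}\times\mathbf Z_p^\times$: on $\mathrm{Pts}_p(C)$, by automorphisms of the completion $\mathbf Q_p$ of $H_p$, i.e. $p$ acts by $(p\cdot\chi)(a)=\chi(pa)$ and $u\in\mathbf Z_p^\times$ acts by $\chi^u(a)=\chi(a)^u$; on $D$, $p$ acts by Frobenius $x\mapsto x^p$ and $u\in\mathbf Z_p^\times$ by $x\mapsto x^u$, where $x^u$ denotes the $\mathbf Z_p$-module structure (limit of $x^{u_k}$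 for integers $u_k\to u$ $p$-adically) on $1+\mathfrak m_C$ and on $1+\mathfrak m_{C^\flat}$. *)

(* Defs.v *)
From HB Require Import structures.
From mathcomp Require Import all_boot all_order all_algebra.
From mathcomp Require Import all_classical all_reals.
From mathcomp Require Import topology.
From mathcomp Require Import metric_structure.

Set Implicit Arguments.
Unset Strict Implicit.
Unset Printing Implicit Defensive.

Import Order.TTheory GRing.Theory Num.Theory.

Local Open Scope classical_set_scope.
Local Open Scope ring_scope.

(* The library's normedZmodType is unusable for a nonarchimedean absolute
   value, because it requires `|x *+ n| = `|x| *+ n.  Here the absolute value is
   a separate operation, tied to the library's metric (hence to its topology,
   its limits and its completeness) by [mdist_absval]. *)
HB.mixin Record Metric_isUltrametricField (R : realType) C
    & GRing.Field C & Metric R C := {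
  absval : C -> R ;
  absval_ge0 : forall x, 0 <= absval x ;
  absval_eq0 : forall x, (absval x == 0) = (x == 0) ;
  absvalM : forall x y, absval (x * y) = absval x * absval y ;
  absvalD_le_max : forall x y,
    absval (x + y) <= Num.max (absval x) (absval y) ;
  mdist_absval : forall x y : C, mdist x y = absval (x - y)
}.

#[short(type="completeUltrametricFieldType")]
HB.structure Definition CompleteUltrametricField (R : realType) :=
  {C of GRing.Field C & Metric R C & Complete C
      & Metric_isUltrametricField R C}.

Section PerfectoidField.
Variables (R : realType) (C : completeUltrametricFieldType R).

Definition integers : set C := [set x | absval x <= 1].
Definition maxideal : set C := [set x | absval x < 1].
Definition one_plus_maxideal : set C := [set 1 + y | y in maxideal].

Definition value_group : set R := [set absval x | x in [set x : C | x != 0]].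

(* The residue field O_C / m_C has characteristic the prime p iff the image of
   p in it vanishes; this is the first clause. *)
Definition perfectoid (p : nat) : Prop :=
  [/\ maxideal p%:R,
      ~ (value_group `<=` isolated (value_group : set R^o))
    & forall x, integers x ->
        exists y z, [/\ integers y, integers z & x = y ^+ p + p%:R * z]].

End PerfectoidField.

Arguments integers {R} C.
Arguments maxideal {R} C.
Arguments one_plus_maxideal {R} C.
Arguments value_group {R} C.
Arguments perfectoid {R} C p.

Section Zinvp.
Variable p : nat.

Definition Zinvp : {pred rat} :=
  [pred a | `[< exists n, p%:R ^+ n * a \is a Num.int >]].

Lemma ZinvpP (a : rat) :
  reflect (exists n, p%:R ^+ n * a \is a Num.int) (a \in Zinvp).
Proof. exact: asboolP. Qed.

Lemma Zinvp_zmod_closed : zmod_closed Zinvp.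
Proof.
split=> [|a b /ZinvpP[m am] /ZinvpP[n bn]]; apply/ZinvpP.
  by exists 0; rewrite mulr0 rpred0.
exists (m + n)%N; rewrite mulrBr exprD rpredB//.
  by rewrite mulrAC rpredM// rpredX// natr_int.
by rewrite -mulrA rpredM// rpredX// natr_int.
Qed.
HB.instance Definition _ := GRing.isZmodClosed.Build rat Zinvp Zinvp_zmod_closed.

Record Hp := MkHp { Hp_val :> rat ; Hp_valP : Hp_val \in Zinvp }.
HB.instance Definition _ := [isSub for Hp_val].
HB.instance Definition _ := [Choice of Hp by <:].
HB.instance Definition _ := [SubChoice_isSubZmodule of Hp by <:].

Definition Zinvp_nneg : {pred rat} := [predI Zinvp & [pred a | 0 <= a]].

Lemma Zinvp_nneg_addr_closed : addr_closed Zinvp_nneg.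
Proof.
split=> [|a b /andP[/= aZ a0] /andP[/= bZ b0]]; apply/andP; split => //=.
- exact: rpred0.
- by rewrite /= rpredD.
- exact: addr_ge0.
Qed.
HB.instance Definition _ :=
  GRing.isAddClosed.Build rat Zinvp_nneg Zinvp_nneg_addr_closed.

Record Hpp := MkHpp { Hpp_val :> rat ; Hpp_valP : Hpp_val \in Zinvp_nneg }.
HB.instance Definition _ := [isSub for Hpp_val].
HB.instance Definition _ := [Choice of Hpp by <:].
HB.instance Definition _ :=
  GRing.SubChoice_isSubNmodule.Build rat Zinvp_nneg Hpp Zinvp_nneg_addr_closed.

Lemma Hpp_in_Hp (a : Hpp) : Hpp_val a \in Zinvp.
Proof. by case: a => a /= /andP[]. Qed.

Definition Hp_of_Hpp (a : Hpp) : Hp := MkHp (Hpp_in_Hp a).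

Lemma scale_subproof (k : int) (a : Hpp) : p%:R ^ k * Hpp_val a \in Zinvp_nneg.
Proof.
case: a => a /= /andP[/= /ZinvpP[n an] a0]; apply/andP; split => /=; last first.
  by apply: mulr_ge0 => //; apply: exprz_ge0.
apply/ZinvpP; case: k => k.
  by exists n; rewrite mulrCA rpredM// rpredX// natr_int.
exists (n + k.+1)%N.
have [p0|p0] := eqVneq (p%:R : rat) 0.
  by rewrite p0 addnS expr0n mul0r rpred0.
rewrite exprD -mulrA (_ : _ * (_ * a) = a)// mulrA.
by rewrite (_ : _ ^ Negz k = (p%:R ^+ k.+1)^-1)// mulfV ?mul1r// expf_neq0.
Qed.

(* p^k * a for k in Z *)
Definition Hpp_scale (k : int) (a : Hpp) : Hpp := MkHpp (scale_subproof k a).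

Lemma one_subproof : 1 \in Zinvp_nneg.
Proof.
apply/andP; split => //=; apply/ZinvpP; exists 0.
by rewrite mulr1 expr0.
Qed.

(* 1/p^n *)
Definition Hpp_invp (n : nat) : Hpp := Hpp_scale (- n%:Z) (MkHpp one_subproof).

Definition padic_val (a : rat) : int :=
  (logn p `|numq a|)%:Z - (logn p `|denq a|)%:Z.

Definition padic_abs (a : rat) : rat :=
  if a == 0 then 0 else p%:R ^ (- padic_val a).

Lemma padic_val_nprime (a : rat) : ~~ prime p -> padic_val a = 0.
Proof.
have logn0n (n : nat) : ~~ prime p -> logn p n = 0%N.
  by move=> /negbTE np; rewrite lognE np.
by move=> np; rewrite /padic_val logn0n// logn0n// subrr.
Qed.

Lemma padic_val_frac (m n : int) : m != 0 -> n != 0 ->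
  padic_val (m%:~R / n%:~R) = (logn p `|m|)%:Z - (logn p `|n|)%:Z.
Proof.
move=> m0 n0; set a := _ / _.
have a0 : a != 0 by rewrite mulf_neq0 ?invr_eq0 ?intr_eq0.
have /(congr1 absz) : numq a * n = m * denq a.
  apply: (@intr_inj rat); rewrite !intrM numqE /a.
  by rewrite mulrAC divfK ?intr_eq0// mulrC.
rewrite !abszM => /(congr1 (logn p)).
rewrite !lognM ?absz_gt0 ?numq_eq0 ?denq_eq0// /padic_val => h.
by apply/eqP; rewrite subr_eq addrAC eq_sym subr_eq -!PoszD h eqxx.
Qed.

Lemma logn_abszD (x y : int) : x != 0 -> y != 0 -> x + y != 0 ->
  (minn (logn p (absz x)) (logn p (absz y)) <= logn p (absz (x + y)%R))%N.
Proof.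
move=> x0 y0 xy0; have [pp|/negbTE np] := boolP (prime p); last first.
  by rewrite lognE np min0n.
rewrite -pfactor_dvdn ?absz_gt0//.
set k := minn _ _.
have -> : (p ^ k %| absz (x + y)%R)%N = ((p ^ k)%N%:Z %| x + y)%Z by [].
rewrite rpredD// ?dvdzE/= pfactor_dvdn ?absz_gt0//.
  exact: geq_minl.
exact: geq_minr.
Qed.

Lemma padic_valD (a b : rat) : a != 0 -> b != 0 -> a + b != 0 ->
  Num.min (padic_val a) (padic_val b) <= padic_val (a + b).
Proof.
move=> a0 b0 ab0; set da := denq a; set db := denq b.
have da0 : da != 0 by exact: denq_neq0.
have db0 : db != 0 by exact: denq_neq0.
have dab0 : da * db != 0 by exact: mulf_neq0.
have ea : a = (numq a * db)%:~R / (da * db)%:~R.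
  by rewrite !intrM invfM mulrACA divff ?mulr1 ?divq_num_den// intr_eq0.
have eb : b = (numq b * da)%:~R / (da * db)%:~R.
  rewrite !intrM invfM [_^-1 * _]mulrC mulrACA divff ?mulr1 ?divq_num_den//.
  by rewrite intr_eq0.
have eab : a + b = (numq a * db + numq b * da)%:~R / (da * db)%:~R.
  by rewrite {1}ea {1}eb intrD mulrDl.
have x0 : numq a * db != 0 by rewrite mulf_neq0 ?numq_eq0.
have y0 : numq b * da != 0 by rewrite mulf_neq0 ?numq_eq0.
have xy0 : numq a * db + numq b * da != 0.
  by apply: contra_neq ab0 => h; rewrite eab h mul0r.
rewrite eab {1}ea {1}eb !padic_val_frac//.
have := logn_abszD x0 y0 xy0.
rewrite geq_min ge_min !lerD2r !lez_nat.
by case/orP => ->; rewrite ?orbT.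
Qed.

Lemma padic_absN (a : rat) : padic_abs (- a) = padic_abs a.
Proof.
by rewrite /padic_abs /padic_val oppr_eq0 numqN denqN abszN.
Qed.

Lemma padic_abs_eq0 (a : rat) : padic_abs a = 0 -> a = 0.
Proof.
rewrite /padic_abs; case: eqVneq => // a0.
have [pp|np] := boolP (prime p); last first.
  by rewrite padic_val_nprime// oppr0 expr0z => /eqP; rewrite oner_eq0.
by move/eqP; rewrite expfz_eq0 pnatr_eq0 eqn0Ngt prime_gt0// andbF.
Qed.

Lemma padic_abs_ge0 (a : rat) : 0 <= padic_abs a.
Proof. by rewrite /padic_abs; case: ifP => // _; rewrite exprz_ge0. Qed.

Lemma padic_absD (a b : rat) :
  padic_abs (a + b) <= Num.max (padic_abs a) (padic_abs b).
Proof.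
have [->|a0] := eqVneq a 0; first by rewrite add0r le_max lexx orbT.
have [->|b0] := eqVneq b 0; first by rewrite addr0 le_max lexx.
have [ab0|ab0] := eqVneq (a + b) 0.
  by rewrite ab0 {1}/padic_abs eqxx le_max padic_abs_ge0.
have := padic_valD a0 b0 ab0.
rewrite /padic_abs (negbTE a0) (negbTE b0) (negbTE ab0).
have [pp|np] := boolP (prime p); last first.
  by rewrite !padic_val_nprime// oppr0 expr0z le_max lexx.
have p1 : (1 : rat) < p%:R by rewrite ltr1n prime_gt1.
by rewrite le_max !ler_eXz2l// !lerN2 ge_min.
Qed.

Let Hpp_dist (a b : Hpp) : rat := padic_abs (Hpp_val a - Hpp_val b).

Let Hpp_distxx a : Hpp_dist a a = 0.
Proof. by rewrite /Hpp_dist subrr /padic_abs eqxx. Qed.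

Let Hpp_dist_positivity a b : Hpp_dist a b = 0 -> a = b.
Proof. by move=> /padic_abs_eq0/subr0_eq/val_inj. Qed.

Let Hpp_dist_sym a b : Hpp_dist a b = Hpp_dist b a.
Proof. by rewrite /Hpp_dist -padic_absN opprB. Qed.

Let Hpp_dist_triangle b a c : Hpp_dist a c <= Hpp_dist a b + Hpp_dist b c.
Proof.
rewrite /Hpp_dist -(subrKA (Hpp_val b)); apply: le_trans (padic_absD _ _) _.
by rewrite ge_max lerDl lerDr !padic_abs_ge0.
Qed.

(* The topology on H_p^+ is the one induced by Q_p: the p-adic distance. *)
HB.instance Definition _ := isMetric.Build rat Hpp
  Hpp_distxx Hpp_dist_positivity Hpp_dist_sym Hpp_dist_triangle.

End Zinvp.

Section Points.
Variables (p : nat) (R : realType) (C : completeUltrametricFieldType R).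

Definition Pts : set (Hpp p -> C) :=
  [set chi : Hpp p -> C | [/\ chi 0 = 1, (forall a b : Hpp p, chi (a + b) = chi a * chi b)
                & continuous chi]].

Definition Hom_Hp : set (Hp p -> C) :=
  [set psi : Hp p -> C | (forall a, one_plus_maxideal C (psi a))
             /\ (forall a b : Hp p, psi (a + b) = psi a * psi b)].

Definition restrict_Hpp (psi : Hp p -> C) : Hpp p -> C :=
  fun a => psi (Hp_of_Hpp a).

Definition beta (chi : Hpp p -> C) : nat -> C := fun n => chi (Hpp_invp p n).

End Points.

Section Tilt.
Variables (p : nat) (R : realType) (C : completeUltrametricFieldType R).

(* The operations of C^flat are defined on all sequences; they are meaningful
   on [tilt].  Multiplication, one and natural powers are componentwise. *)
Definition tilt : set (nat -> C) := [set x | forall n, x n.+1 ^+ p = x n].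

Definition tilt_one : nat -> C := fun=> 1.

Definition tilt_exp (x : nat -> C) (m : nat) : nat -> C := fun n => x n ^+ m.

Definition tilt_add (x y : nat -> C) : nat -> C :=
  fun n => lim ((x (n + m)%N + y (n + m)%N) ^+ (p ^ m) @[m --> \oo]).

Definition tilt_abs (x : nat -> C) : R := absval (x 0%N).

Definition tilt_maxideal : set (nat -> C) :=
  [set x | tilt x /\ tilt_abs x < 1].

Definition one_plus_tilt_maxideal : set (nat -> C) :=
  [set tilt_add tilt_one y | y in tilt_maxideal].

(* Convergence of the sequence x_k to z in C^flat; the difference x_k - z is
   the h such that x_k = z + h. *)
Definition tilt_cvg (x : nat -> nat -> C) (z : nat -> C) : Prop :=
  forall e : R, 0 < e -> \forall k \near \oo,
    exists h, [/\ tilt h, tilt_abs h < e & x k = tilt_add z h].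

Definition tilt_lim (x : nat -> nat -> C) : nat -> C :=
  get [set z | tilt z /\ tilt_cvg x z].

End Tilt.

Arguments tilt_exp {R C} x m.
Arguments one_plus_tilt_maxideal p {R} C.

Section Actions.
Variable p : nat.

(* Z_p as the inverse limit of the Z/p^k: u k is the residue of u mod p^k in
   [0, p^k[, so that the integers u k tend p-adically to u. *)
Record padic_int := PadicInt {
  padic_res :> nat -> nat ;
  padic_resP : forall k, (padic_res k.+1 %% p ^ k)%N = padic_res k
}.

Definition padic_unit (u : padic_int) : Prop :=
  exists v : padic_int, forall k, u k * v k = 1 %[mod p ^ k].

Record Zp_units := MkZpUnit {
  Zp_unit_val :> padic_int ;
  Zp_unitP : padic_unit Zp_unit_val
}.

(* Q_p^* = p^Z x Z_p^*: the pair (k, u) stands for p^k * u. *)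
Definition Qp_units : Type := (int * Zp_units)%type.

Variables (R : realType) (C : completeUltrametricFieldType R).

Definition zp_pow (x : C) (u : padic_int) : C := lim (x ^+ u k @[k --> \oo]).

Definition tilt_zp_pow (x : nat -> C) (u : padic_int) : nat -> C :=
  tilt_lim p (fun k => tilt_exp x (u k)).

Definition frob (x : nat -> C) : nat -> C := tilt_exp x p.

Definition frob_inv (x : nat -> C) : nat -> C := fun n => x n.+1.

Lemma frobK (x : nat -> C) : tilt p x -> frob_inv (frob x) = x.
Proof. by move=> xt; apply/funext => n; exact: xt. Qed.

Lemma frob_invK (x : nat -> C) : tilt p x -> frob (frob_inv x) = x.
Proof. by move=> xt; apply/funext => n; exact: xt. Qed.

Definition frobz (k : int) (x : nat -> C) : nat -> C :=
  match k with
  | Posz n => iter n frob x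
  | Negz n => iter n.+1 frob_inv x
  end.

Definition act_Pts (g : Qp_units) (chi : Hpp p -> C) : Hpp p -> C :=
  fun a => zp_pow (chi (Hpp_scale g.1 a)) g.2.

Definition act_tilt (g : Qp_units) (x : nat -> C) : nat -> C :=
  tilt_zp_pow (frobz g.1 x) g.2.

End Actions.

(* Main.v *)
Require Import Defs.
From mathcomp Require Import all_boot all_order all_algebra.
From mathcomp Require Import all_classical all_reals.
From mathcomp Require Import topology.
From mathcomp Require Import metric_structure sequences.
From mathcomp Require Import zify ring lra.

(** Everything rests on one contraction: if x and y are integral and
    |x - y| <= r, where |p| <= r < 1, then |x^p - y^p| <= r * |x - y|, because
    the expansion of ((x - y) + y)^p consists of y^p, of (x - y)^p, and of terms
    divisible by p * (x - y) ([frob_contract]). Iterating it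
    ([frob_iter_contract]) has two uses.

    For x in 1 + m, the powers x^(p^m) tend to 1 ([one_plus_powers_geometric]).
    Since the p-integral elements of Z[1/p] are integers, two elements of H_p^+
    that are p-adically close differ by a multiple of p^m
    ([padic_abs_small]), so every character of H_p^+ with values in 1 + m is
    continuous. Conversely, if chi is continuous, then chi(a)^(p^n) =
    chi(p^n a) tends to 1, and x^p in 1 + m forces x in 1 + m
    ([one_plus_root]). Hence the points are exactly the characters with values
    in 1 + m ([PtsP]), and such a character extends uniquely from the cone to
    the group of differences Z[1/p]. As H_p^+ is the increasing union of the
    monoids generated by the 1/p^n, a character is also the same as the
    compatible system of the values chi(1/p^n).

    The second use concerns the tilt. An integral sequence u with
    u_(n+1)^p = u_n mod p lifts to the unique integral sequence of p-power roots
    congruent to it mod p, namely the limits of u_(n+m)^(p^m)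
    ([tilt_lift_tilt], [tilt_lift_congr], [tilt_lift_unique]); this is the
    classical description of the integers of the tilt as the inverse limit of
    O_C / p along Frobenius. The sum in the tilt is the lift of the
    componentwise sum, so differences exist and are controlled mod p
    ([tilt_subP]). It follows that 1 + m of the tilt consists of the sequences
    of p-power roots with all terms in 1 + m ([one_plus_tilt_maxidealE]), which
    is exactly where beta takes its values.

    For the equivariance, the power x^u in 1 + m is a limit of the x^(u_k) by
    the first use. In the tilt, convergence to a limit is implied by
    convergence at every stage n ([tilt_cvg_pointwise]) and limits are unique
    ([tilt_cvg_unique]); the exponentiation of the tilt is therefore
    computed componentwise ([tilt_zp_powE]), and the two actions agree term by
    term. *)

Set Implicit Arguments.
Unset Strict Implicit.
Unset Printing Implicit Defensive.

Import Order.TTheory GRing.Theory Num.Theory.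
Import metricType_numDomainType.

Local Open Scope classical_set_scope.
Local Open Scope ring_scope.

(** * Ultrametric absolute values and limits *)

Section UltrametricField.
Variables (R : realType) (C : completeUltrametricFieldType R).
Implicit Types (x y z : C) (r s : R).

Lemma absval0 : absval (0 : C) = 0.
Proof. by apply/eqP; rewrite absval_eq0. Qed.

Lemma absval1 : absval (1 : C) = 1.
Proof.
have v1 : absval (1 : C) != 0 by rewrite absval_eq0 oner_eq0.
by apply: (mulfI v1); rewrite -absvalM !mulr1.
Qed.

Lemma absvalX x n : absval (x ^+ n) = absval x ^+ n.
Proof. by elim: n => [|n IH]; rewrite ?expr0 ?absval1// !exprS absvalM IH. Qed.

Lemma absvalN x : absval (- x) = absval x.
Proof.
apply/eqP; rewrite -(@eqrXn2 _ 2)// ?absval_ge0//.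
by rewrite -!absvalX sqrrN.
Qed.

Lemma absvalBC x y : absval (x - y) = absval (y - x).
Proof. by rewrite -absvalN opprB. Qed.

Lemma absvalV x : absval x^-1 = (absval x)^-1.
Proof.
have [->|x0] := eqVneq x 0; first by rewrite invr0 absval0 invr0.
have v0 : absval x != 0 by rewrite absval_eq0.
by apply: (mulfI v0); rewrite -absvalM !mulfV// absval1.
Qed.

Lemma absvalD_le r x y : absval x <= r -> absval y <= r -> absval (x + y) <= r.
Proof. by move=> xr yr; apply: le_trans (absvalD_le_max _ _) _; rewrite ge_max xr. Qed.

Lemma absvalD_lt r x y : absval x < r -> absval y < r -> absval (x + y) < r.
Proof.
by move=> xr yr; apply: le_lt_trans (absvalD_le_max _ _) _; rewrite gt_max xr.
Qed.

Lemma absvalB_le_trans y r x z :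
  absval (x - y) <= r -> absval (y - z) <= r -> absval (x - z) <= r.
Proof. by rewrite -(subrKA y x (- z)); exact: absvalD_le. Qed.

Lemma absvalB_lt_trans y r x z :
  absval (x - y) < r -> absval (y - z) < r -> absval (x - z) < r.
Proof. by rewrite -(subrKA y x (- z)); exact: absvalD_lt. Qed.

Lemma absval_le_near y r x : absval (x - y) <= r -> absval y <= r -> absval x <= r.
Proof. by move=> xy yr; rewrite -(subrK y x); exact: absvalD_le. Qed.

Lemma absval_sum_le (I : Type) (l : seq I) (P : pred I) (F : I -> C) r :
  0 <= r -> (forall i, P i -> absval (F i) <= r) ->
  absval (\sum_(i <- l | P i) F i) <= r.
Proof.
move=> r0 Fr; elim/big_rec: _ => [|i x Pi xr]; first by rewrite absval0.
by apply: absvalD_le => //; exact: Fr.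
Qed.

Lemma absval_natr_le1 n : absval (n%:R : C) <= 1.
Proof.
elim: n => [|n IH]; first by rewrite absval0.
by rewrite -natr1; apply: absvalD_le => //; rewrite absval1.
Qed.

Lemma absvalX_le1 x n : absval x <= 1 -> absval (x ^+ n) <= 1.
Proof. by move=> x1; rewrite absvalX exprn_ile1// absval_ge0. Qed.

Lemma one_plus_maxidealE x : one_plus_maxideal C x <-> absval (x - 1) < 1.
Proof.
split=> [[y /= y1 <-]|x1]; first by rewrite addrAC subrr add0r.
by exists (x - 1) => //=; rewrite addrC subrK.
Qed.

Lemma absval_one_plus x : absval (x - 1) < 1 -> absval x = 1.
Proof.
move=> x1; apply/eqP; rewrite eq_le; apply/andP; split.
  by apply: (absval_le_near (ltW x1)); rewrite absval1.
rewrite leNgt; apply/negP => lt_x1.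
have : absval (1 : C) < 1 by rewrite -(subrK x 1) absvalD_lt// absvalBC.
by rewrite absval1 ltxx.
Qed.

Lemma one_plusM x y :
  absval (x - 1) < 1 -> absval (y - 1) < 1 -> absval (x * y - 1) < 1.
Proof.
move=> x1 y1; apply: (@absvalB_lt_trans y) => //.
by rewrite -[X in _ - X]mul1r -mulrBl absvalM (absval_one_plus y1) mulr1.
Qed.

Lemma one_plusV x : absval (x - 1) < 1 -> absval (x^-1 - 1) < 1.
Proof.
move=> x1; have vx := absval_one_plus x1.
have x0 : x != 0 by rewrite -absval_eq0 vx oner_eq0.
have -> : x^-1 - 1 = x^-1 * (1 - x) by rewrite mulrBr mulr1 mulVf.
by rewrite absvalM absvalV vx invr1 mul1r absvalBC.
Qed.

Lemma absvalX_sub1_le x n : absval x <= 1 ->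
  absval (x ^+ n - 1) <= absval (x - 1).
Proof.
move=> x1; elim: n => [|n IH]; first by rewrite subrr absval0 absval_ge0.
apply: (@absvalB_le_trans x) => //.
rewrite exprS -[X in _ - X]mulr1 -mulrBr absvalM -[leRHS]mul1r.
by apply: ler_pM IH => //; exact: absval_ge0.
Qed.

Lemma one_plusX x n : absval (x - 1) < 1 -> absval (x ^+ n - 1) < 1.
Proof.
by move=> x1; apply: le_lt_trans (x1); apply: absvalX_sub1_le; rewrite absval_one_plus.
Qed.

Lemma cvg_absvalP (u : nat -> C) (l : C) :
  u @ \oo --> l <-> forall e, 0 < e -> \forall n \near \oo, absval (u n - l) < e.
Proof.
split=> [/cvgrPdist_lt ul e /ul|ul]; last apply/cvgrPdist_lt => e /ul.
  by apply: filterS => n; rewrite mdist_absval absvalBC.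
by apply: filterS => n; rewrite mdist_absval absvalBC.
Qed.

Lemma cvg_lim_absval (u : nat -> C) (l : C) : u @ \oo --> l -> lim (u @ \oo) = l.
Proof. by apply: cvg_lim; exact: metric_hausdorff. Qed.

Lemma geometric_lt r e : 0 <= r < 1 -> 0 < e -> \forall n \near \oo, r ^+ n < e.
Proof.
move=> /andP[r0 r1] e0.
have : (fun n => r ^+ n) @ \oo --> (0 : R^o).
  by apply: cvg_expr; rewrite ger0_norm.
move/(@cvgrPdist_lt R R^o)/(_ e e0).
by apply: filterS => n /=; rewrite /mdist/= subr0 ger0_norm// exprn_ge0.
Qed.

(** By the ultrametric inequality, u_n - u_N is no larger than the largest of
    the consecutive differences between them, so the Cauchy condition needs no
    summation of the bounds. *)
Lemma cvg_geometric_step (u : nat -> C) r : 0 <= r < 1 ->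
  (forall n, absval (u n.+1 - u n) <= r ^+ n) -> cvg (u @ \oo).
Proof.
move=> r01 ur; apply: cauchy_cvg; apply: cauchy_exP => e e0.
have [N _ rN] := geometric_lt r01 e0.
exists (u N); exists N => // n /= Nn; rewrite ballEmdist/= mdist_absval.
apply: le_lt_trans (rN N (leqnn _)); rewrite absvalBC.
rewrite -(subnKC Nn); elim: (n - N)%N => [|k IH].
  by rewrite addn0 subrr absval0 exprn_ge0//; case/andP: r01.
rewrite addnS; apply: absvalB_le_trans IH.
apply: le_trans (ur _) _; case/andP: r01 => r0 /ltW r1.
by rewrite exprD ler_piMr ?exprn_ge0 ?exprn_ile1.
Qed.

Lemma cvg_absval_le (u : nat -> C) (l a : C) r :
  u @ \oo --> l -> (forall n, absval (u n - a) <= r) -> absval (l - a) <= r.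
Proof.
move=> /cvg_absvalP ul ua; rewrite leNgt; apply/negP => rl.
have d0 : 0 < absval (l - a).
  by apply: le_lt_trans rl; apply: le_trans (ua 0%N); exact: absval_ge0.
have [n _ /(_ n (leqnn _)) un] := ul _ d0.
suff : absval (l - a) < absval (l - a) by rewrite ltxx.
apply: (@absvalB_lt_trans (u n)); first by rewrite absvalBC.
exact: le_lt_trans rl.
Qed.

Lemma cvg_mul (u v : nat -> C) (a b : C) :
  u @ \oo --> a -> v @ \oo --> b -> (fun n => u n * v n) @ \oo --> a * b.
Proof.
move=> /cvg_absvalP ua /cvg_absvalP vb; apply/cvg_absvalP => e e0.
pose K := 1 + absval a + absval b.
have va := absval_ge0 a; have vvb := absval_ge0 b.
have K0 : 0 < K by rewrite /K; lra.
have eK0 : 0 < e / K by rewrite divr_gt0.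
have aK (c : R) x : 0 <= c < K -> absval x < e / K -> c * absval x < e.
  move=> /andP[c0 cK] xK; apply: (@le_lt_trans _ _ (c * (e / K))).
    by rewrite ler_wpM2l// ltW.
  by rewrite mulrCA gtr_pMr// ltr_pdivrMr// mul1r.
near=> n.
have un : absval (u n - a) < e / K by near: n; exact: ua.
have un1 : absval (u n - a) < 1 by near: n; exact: ua.
have vn : absval (v n - b) < e / K by near: n; exact: vb.
have -> : u n * v n - a * b =
    (u n - a) * (v n - b) + (a * (v n - b) + b * (u n - a)) by ring.
apply: absvalD_lt; last apply: absvalD_lt; rewrite absvalM; apply: aK => //.
- by rewrite absval_ge0/= (lt_le_trans un1)// /K; lra.
- by rewrite va/= /K; lra.
- by rewrite vvb/= /K; lra.
Unshelve. all: by end_near. Qed.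

Lemma cvg_exp (u : nat -> C) (a : C) m :
  u @ \oo --> a -> (fun n => u n ^+ m) @ \oo --> a ^+ m.
Proof.
move=> ua; elim: m => [|m IH]; first exact: cvg_cst.
by under eq_cvg do rewrite exprS; rewrite exprS; exact: cvg_mul.
Qed.

End UltrametricField.

(** * Frobenius modulo p *)

Section ResidueCharacteristic.
Variables (p : nat) (R : realType) (C : completeUltrametricFieldType R).
Hypothesis p_prime : prime p.
Implicit Types (x y z : C) (r s : R).

Lemma absval_frobD x y : absval x <= 1 -> absval y <= 1 ->
  absval ((x + y) ^+ p - (x ^+ p + y ^+ p)) <= absval (p%:R : C) * absval y.
Proof.
case: p p_prime => [|q] // q_prime x1 y1.
rewrite exprDn big_ord_recl big_ord_recr/= subn0 expr0 mulr1 bin0 mulr1n.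
rewrite /bump/= add1n subnn expr0 mul1r binn mulr1n.
set S := \sum_(i < q) _; rewrite [X in absval X](_ : _ = S); last by ring.
apply: absval_sum_le => [|i _]; first by rewrite mulr_ge0 ?absval_ge0.
rewrite /= add1n -mulr_natr.
have /dvdnP[c ->] : (q.+1 %| 'C(q.+1, i.+1))%N.
  by apply: prime_dvd_bin => //=; exact: (ltn_ord i).
rewrite natrM exprS [X in absval X](_ : _ =
  q.+1%:R * y * (x ^+ (q.+1 - i.+1) * y ^+ i * c%:R)); last by ring.
rewrite -absvalM [leLHS]absvalM ler_piMr ?absval_ge0//.
rewrite absvalM mulr_ile1 ?absval_ge0 ?absval_natr_le1//.
by rewrite absvalM mulr_ile1 ?absval_ge0 ?absvalX_le1.
Qed.

Lemma absval_frobD_le x y : absval x <= 1 -> absval y <= 1 ->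
  absval ((x + y) ^+ p - (x ^+ p + y ^+ p)) <= absval (p%:R : C).
Proof.
move=> x1 y1; apply: le_trans (absval_frobD x1 y1) _.
by rewrite ler_piMr ?absval_ge0.
Qed.

(** Frobenius being additive mod p, it commutes with the opposite mod p; this
    form avoids distinguishing p = 2 from odd p. *)
Lemma absval_frobN x : absval x <= 1 ->
  absval ((- x) ^+ p + x ^+ p) <= absval (p%:R : C).
Proof.
move=> x1; have := @absval_frobD_le (- x) x.
by rewrite addNr expr0n gtn_eqF ?prime_gt0// sub0r !absvalN; exact.
Qed.

Section Contraction.
Variable r : R.
Hypotheses (pr : absval (p%:R : C) <= r).

(** Writing x = y + d, the terms of x^p - y^p are d^p, where |d^p| <= |d|^2,
    and multiples of p * d. *)
Lemma frob_contract s x y : absval x <= 1 -> absval y <= 1 -> s <= r ->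
  absval (x - y) <= s -> absval (x ^+ p - y ^+ p) <= r * s.
Proof.
move=> x1 y1 sr; set d := x - y => ds.
have r0 : 0 <= r by apply: le_trans pr; exact: absval_ge0.
have d1 : absval d <= 1 by apply: absvalD_le => //; rewrite absvalN.
apply: (@absvalB_le_trans _ _ (y ^+ p + d ^+ p)).
  have -> : x = y + d by rewrite addrC subrK.
  by apply: le_trans (absval_frobD y1 d1) _; rewrite ler_pM ?absval_ge0.
rewrite [y ^+ p + _]addrC addrK absvalX -(prednK (prime_gt0 p_prime)) exprS mulrC.
rewrite ler_pM ?absval_ge0 ?exprn_ge0 ?absval_ge0//.
apply: (@le_trans _ _ (absval d)); last exact: le_trans ds sr.
rewrite -(prednK (n := p.-1)) ?exprS ?ler_piMr ?exprn_ile1 ?absval_ge0//.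
by rewrite -ltnS (prednK (prime_gt0 p_prime)) prime_gt1.
Qed.

Lemma frob_iter_contract m x y : absval x <= 1 -> absval y <= 1 -> r <= 1 ->
  absval (x - y) <= r -> absval (x ^+ (p ^ m) - y ^+ (p ^ m)) <= r ^+ m.+1.
Proof.
move=> x1 y1 r1 xy; have r0 : 0 <= r by apply: le_trans pr; exact: absval_ge0.
elim: m => [|m IH]; first by rewrite expn0 !expr1.
rewrite expnSr !exprM [r ^+ m.+2]exprS; apply: frob_contract => //.
- exact: absvalX_le1.
- exact: absvalX_le1.
- by rewrite exprS ler_piMr// exprn_ile1.
Qed.

End Contraction.

Hypothesis p_lt1 : absval (p%:R : C) < 1.

(** The residue field has no nontrivial p-th roots of 1, as (x - 1)^p = x^p - 1
    mod p. *)
Lemma one_plus_root x : absval (x ^+ p - 1) < 1 -> absval (x - 1) < 1.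
Proof.
move=> xp1; have x1 : absval x <= 1.
  by rewrite -(@expr_le1 _ p) ?prime_gt0 ?absval_ge0// -absvalX absval_one_plus.
have x11 : absval (x - 1) <= 1 by rewrite absvalD_le// absvalN absval1.
have := @absval_frobD_le 1 (x - 1); rewrite absval1 => /(_ (lexx _) x11).
rewrite [1 + (x - 1)]addrC subrK expr1n => px.
rewrite -(@expr_lt1 _ p) ?absval_ge0 ?prime_gt0// -absvalX.
rewrite [X in absval X](_ : _ = x ^+ p - 1 - (x ^+ p - (1 + (x - 1) ^+ p))).
  by rewrite absvalD_lt// absvalN (le_lt_trans px).
by ring.
Qed.

Lemma one_plus_root_iter m x : absval (x ^+ (p ^ m) - 1) < 1 -> absval (x - 1) < 1.
Proof.
elim: m => [|m IH]; first by rewrite expn0 expr1.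
by rewrite expnSr exprM => /one_plus_root.
Qed.

(** The ratio is the larger of |p| and |x - 1|, the least value that
    [frob_iter_contract] accepts. *)
Lemma one_plus_powers_geometric x : absval (x - 1) < 1 ->
  exists2 r, 0 <= r < 1 & forall m, absval (x ^+ (p ^ m) - 1) <= r ^+ m.+1.
Proof.
move=> x1; pose r := Num.max (absval (p%:R : C)) (absval (x - 1)).
exists r; first by rewrite le_max absval_ge0 gt_max p_lt1.
move=> m; rewrite -[X in _ - X](expr1n _ (p ^ m)).
apply: frob_iter_contract => //.
- by rewrite le_max lexx.
- by rewrite absval_one_plus.
- by rewrite absval1.
- by rewrite ge_max !ltW.
- by rewrite le_max lexx orbT.
Qed.

(** * Lifting sequences that are p-power compatible modulo p *)

Definition frob_compatible (u : nat -> C) :=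
  forall n, absval (u n) <= 1 /\ absval (u n.+1 ^+ p - u n) <= absval (p%:R : C).

(** The inverse of the reduction map from the integers of the tilt to the
    compatible systems of O_C / p. *)
Definition tilt_lift (u : nat -> C) : nat -> C :=
  fun n => lim ((u (n + m)%N ^+ (p ^ m)) @[m --> \oo]).

(** The compatibility u_(n+m+1)^p = u_(n+m) mod p becomes a congruence mod
    p^(m+1) after raising to the power p^m, so the defining sequence converges
    geometrically. *)
Lemma tilt_liftP u : frob_compatible u ->
  forall n, (fun m => u (n + m)%N ^+ (p ^ m)) @ \oo --> tilt_lift u n.
Proof.
move=> uc n; have /cvg_ex[l ul] : cvg ((fun m => u (n + m)%N ^+ (p ^ m)) @ \oo).
  apply: (@cvg_geometric_step _ _ _ (absval (p%:R : C))).
    by rewrite absval_ge0.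
  move=> m; rewrite addnS expnS exprM.
  apply: le_trans (@frob_iter_contract _ (lexx _) _ _ _ _ _ _ _) _.
  - by apply: absvalX_le1; case: (uc (n + m).+1).
  - by case: (uc (n + m)%N).
  - exact: ltW.
  - by case: (uc (n + m)%N).
  - by rewrite exprS ler_piMl ?exprn_ge0 ?absval_ge0// ltW.
by rewrite /tilt_lift (cvg_lim_absval ul).
Qed.

Arguments tilt_liftP [u] _ n.

Lemma tilt_lift_tilt u : frob_compatible u -> tilt p (tilt_lift u).
Proof.
move=> uc n; rewrite -(cvg_lim_absval (cvg_exp (m := p) (tilt_liftP uc n.+1))).
apply: cvg_lim_absval; have := tilt_liftP uc n.
rewrite -cvg_shiftS/=; apply: cvg_trans; apply: near_eq_cvg.
by apply: nearW => m; rewrite addSnnS -exprM -expnSr.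
Qed.

Lemma tilt_lift_congr u : frob_compatible u ->
  forall n, absval (tilt_lift u n - u n) <= absval (p%:R : C).
Proof.
move=> uc n; apply: cvg_absval_le (tilt_liftP uc n) _.
elim=> [|m IH]; first by rewrite addn0 expn0 expr1 subrr absval0 absval_ge0.
apply: absvalB_le_trans IH; rewrite addnS expnS exprM.
apply: le_trans (@frob_iter_contract _ (lexx _) _ _ _ _ _ _ _) _.
- by apply: absvalX_le1; case: (uc (n + m).+1).
- by case: (uc (n + m)%N).
- exact: ltW.
- by case: (uc (n + m)%N).
- by rewrite exprS ler_piMr ?exprn_ile1 ?absval_ge0// ltW.
Qed.

Lemma tilt_lift_le1 u n : frob_compatible u -> absval (tilt_lift u n) <= 1.
Proof.
move=> uc; apply: (@absval_le_near _ _ (u n)); last by case: (uc n).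
by apply: le_trans (tilt_lift_congr uc n) _; exact: ltW.
Qed.

Lemma tilt_iter (x : nat -> C) m n : tilt p x -> x (n + m)%N ^+ (p ^ m) = x n.
Proof.
move=> xt; elim: m => [|m IH]; first by rewrite addn0 expn0 expr1.
by rewrite addnS expnS exprM xt.
Qed.

(** A tilt sequence is recovered from any integral sequence uniformly close to
    it: closeness at stage n + m improves geometrically after raising to the
    p^m-th power. *)
Lemma tilt_lift_unique r (x u : nat -> C) : r < 1 -> tilt p x ->
  (forall n, absval (x n) <= 1) -> (forall n, absval (u n) <= 1) ->
  (forall n, absval (u n - x n) <= r) -> tilt_lift u = x.
Proof.
move=> r1 xt x1 u1 ux; apply/funext => n; apply: cvg_lim_absval.
pose s := Num.max (absval (p%:R : C)) r.
have s01 : 0 <= s < 1 by rewrite le_max absval_ge0 gt_max p_lt1.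
apply/cvg_absvalP => e e0; apply: filterS (geometric_lt s01 e0) => m sm.
case/andP: s01 => s0 s1; rewrite -(tilt_iter m n xt).
apply: le_lt_trans (@frob_iter_contract s _ _ _ _ _ _ _ _) _ => //.
- by rewrite le_max lexx.
- exact: ltW.
- by rewrite le_max ux orbT.
- by apply: le_lt_trans sm; rewrite exprS ler_piMl ?exprn_ge0// ltW.
Qed.

Lemma tilt_le1 (x : nat -> C) : tilt p x -> absval (x 0%N) <= 1 ->
  forall n, absval (x n) <= 1.
Proof.
move=> xt x1 n; rewrite -(@expr_le1 _ (p ^ n)) ?absval_ge0 ?expn_gt0 ?prime_gt0//.
by rewrite -absvalX (tilt_iter n 0 xt).
Qed.

Lemma tilt_frob_compatible (x : nat -> C) : tilt p x ->
  (forall n, absval (x n) <= 1) -> frob_compatible x.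
Proof. by move=> xt x1 n; rewrite xt subrr absval0 absval_ge0. Qed.

Lemma frob_compatibleD (u w : nat -> C) :
  frob_compatible u -> frob_compatible w -> frob_compatible (u \+ w).
Proof.
move=> uc wc n /=; have [u1 un] := uc n; have [w1 wn] := wc n.
have [[uS1 _] [wS1 _]] := (uc n.+1, wc n.+1).
split; first exact: absvalD_le.
apply: absvalB_le_trans (absval_frobD_le uS1 wS1) _.
by rewrite opprD addrACA absvalD_le.
Qed.

Lemma frob_compatibleN (u : nat -> C) :
  frob_compatible u -> frob_compatible (\- u).
Proof.
move=> uc n /=; have [u1 un] := uc n; have [uS1 _] := uc n.+1.
split; first by rewrite absvalN.
have -> : (- u n.+1) ^+ p - - u n =
    ((- u n.+1) ^+ p + u n.+1 ^+ p) - (u n.+1 ^+ p - u n) by ring.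
by rewrite absvalD_le ?absval_frobN// absvalN.
Qed.

Lemma frob_compatibleB (u w : nat -> C) :
  frob_compatible u -> frob_compatible w -> frob_compatible (u \- w).
Proof. by move=> uc wc; exact: frob_compatibleD uc (frob_compatibleN wc). Qed.

Lemma tilt_addE (x y : nat -> C) : tilt_add p x y = tilt_lift (x \+ y).
Proof. by []. Qed.

(** The element x - z of the tilt, for integral x and z, is the lift of the
    componentwise difference. *)
Lemma tilt_subP (x z : nat -> C) : tilt p x -> tilt p z ->
    (forall n, absval (x n) <= 1) -> (forall n, absval (z n) <= 1) ->
  [/\ tilt p (tilt_lift (x \- z)), tilt_add p z (tilt_lift (x \- z)) = x
    & forall n, absval (tilt_lift (x \- z) n - (x n - z n))
                  <= absval (p%:R : C)].
Proof.
move=> xt zt x1 z1; have xzc : frob_compatible (x \- z).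
  by apply: frob_compatibleB; exact: tilt_frob_compatible.
split; [exact: tilt_lift_tilt| |exact: tilt_lift_congr].
rewrite tilt_addE; apply: tilt_lift_unique p_lt1 _ _ _ _ => // n /=.
  by apply: absvalD_le => //; exact: tilt_lift_le1.
rewrite [X in absval X](_ : _ = tilt_lift (x \- z) n - (x n - z n)).
  exact: tilt_lift_congr.
by ring.
Qed.

Lemma one_plus_tilt_maxidealE (x : nat -> C) :
  one_plus_tilt_maxideal p C x <->
  tilt p x /\ forall n, absval (x n - 1) < 1.
Proof.
have t1 : tilt p (tilt_one C) by move=> n; rewrite /tilt_one expr1n.
have c1 : frob_compatible (tilt_one C).
  by apply: tilt_frob_compatible => // n; rewrite absval1.
split=> [[y [yt /= y1] <-]|[xt x1]].
  have yn n : absval (y n) < 1.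
    rewrite -(@expr_lt1 _ (p ^ n)) ?absval_ge0 ?expn_gt0 ?prime_gt0//.
    by rewrite -absvalX (tilt_iter n 0 yt).
  have yc : frob_compatible (tilt_one C \+ y).
    by apply: frob_compatibleD => //; apply: tilt_frob_compatible => // n; exact: ltW.
  rewrite tilt_addE; split=> [|n]; first exact: tilt_lift_tilt.
  apply: (absvalB_lt_trans (le_lt_trans (tilt_lift_congr yc n) p_lt1)).
  by rewrite /= /tilt_one addrC addKr.
have vx n : absval (x n) <= 1 by rewrite absval_one_plus.
have v1 n : absval (tilt_one C n) <= 1 by rewrite absval1.
have [yt yx ycongr] := tilt_subP xt t1 vx v1.
exists (tilt_lift (x \- tilt_one C)) => //; split=> //=.
rewrite /tilt_abs -(subrK (x 0%N - 1) (tilt_lift _ _)).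
by apply: absvalD_lt (x1 0%N); exact: le_lt_trans (ycongr 0%N) p_lt1.
Qed.

(** For a fixed stage n, smallness of x - z in the tilt follows from smallness
    of x_n - z_n, up to the ambiguity |p| which the power p^n makes negligible. *)
Lemma tilt_cvg_pointwise (x : nat -> nat -> C) (z : nat -> C) :
    (forall k, tilt p (x k)) -> tilt p z ->
    (forall k n, absval (x k n) <= 1) -> (forall n, absval (z n) <= 1) ->
    (forall n, (fun k => x k n) @ \oo --> z n) ->
  tilt_cvg p x z.
Proof.
move=> xt zt x1 z1 xz e e0.
have q01 : 0 <= absval (p%:R : C) < 1 by rewrite absval_ge0.
have [n _ qn] := geometric_lt q01 e0.
have {}qn : absval (p%:R : C) ^+ (p ^ n) < e.
  by apply: qn; rewrite /= ltnW// ltn_expl// prime_gt1.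
have d0 : 0 < Num.min 1 e by rewrite lt_min ltr01.
have /cvg_absvalP/(_ _ d0) := xz n; apply: filterS => k.
rewrite lt_min => /andP[d1 de].
have [ht hx hcongr] := tilt_subP (xt k) zt (x1 k) z1.
set h := tilt_lift _ in ht hx hcongr; exists h; split=> //.
rewrite /tilt_abs -(tilt_iter n 0 ht) add0n absvalX.
have : absval (h n) <= Num.max (absval (p%:R : C)) (absval (x k n - z n)).
  rewrite -[in leLHS](subrK (x k n - z n) (h n)).
  by rewrite absvalD_le ?le_max ?lexx ?orbT// hcongr.
rewrite le_max => /orP[] hn.
  by apply: le_lt_trans qn; rewrite lerXn2r// nnegrE absval_ge0.
apply: le_lt_trans de; apply: le_trans (hn).
rewrite ler_iXnr ?expn_gt0 ?prime_gt0// ?absval_ge0//.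
by apply: (le_trans hn); exact: ltW.
Qed.

(** Since tilt_add is a limit that could a priori fail to exist outside the
    integers, the sum with a non-integral z is reduced to the integral case by
    factoring out z: z + h = z * (1 + h / z). *)
Lemma tilt_add_absval_gt1 (z h : nat -> C) : tilt p z -> tilt p h ->
  1 < absval (z 0%N) -> absval (h 0%N) < 1 ->
  absval (tilt_add p z h 0%N) = absval (z 0%N).
Proof.
move=> zt ht z1 h1.
have z0 n : z n != 0.
  apply/negP => /eqP zn; move: z1; rewrite -(tilt_iter n 0 zt) zn.
  by rewrite expr0n gtn_eqF ?expn_gt0 ?prime_gt0// absval0 ltNge ler01.
pose y n := h n / z n.
have yt : tilt p y by move=> n; rewrite /y expr_div_n zt ht.
have y0 : absval (y 0%N) < 1.
  rewrite /y absvalM absvalV ltr_pdivrMr ?(lt_trans _ z1)// mul1r.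
  exact: lt_trans z1.
have ytilt : one_plus_tilt_maxideal p C (tilt_add p (tilt_one C) y) by exists y.
have [wt w1] := (one_plus_tilt_maxidealE _).1 ytilt.
have yc : frob_compatible (tilt_one C \+ y).
  apply: frob_compatibleD; apply: tilt_frob_compatible => //.
  - by move=> n; rewrite /tilt_one expr1n.
  - by move=> n; rewrite absval1.
  - exact: tilt_le1 (ltW y0).
have -> : tilt_add p z h 0%N = z 0%N * tilt_add p (tilt_one C) y 0%N.
  suff zh : (fun m => (z \+ h) (0 + m)%N ^+ (p ^ m)) @ \oo -->
      z 0%N * tilt_add p (tilt_one C) y 0%N by exact: cvg_lim_absval zh.
  apply: cvg_trans (cvg_mul (cvg_cst (z 0%N)) (tilt_liftP yc 0)).
  apply: near_eq_cvg; apply: nearW => m /=.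
  rewrite -(tilt_iter m 0 zt) -exprMn /tilt_one /y.
  by rewrite mulrDr mulr1 mulrCA mulfV// mulr1.
by rewrite absvalM (absval_one_plus (w1 0%N)) mulr1.
Qed.

Lemma tilt_cvg_le1 (x : nat -> nat -> C) (z : nat -> C) : tilt p z ->
  (forall k n, absval (x k n) <= 1) -> tilt_cvg p x z ->
  forall n, absval (z n) <= 1.
Proof.
move=> zt x1 xz; apply: tilt_le1 => //; rewrite leNgt; apply/negP => z1.
have [k _ /(_ k (leqnn _)) [h [ht h1 xk]]] := xz 1 ltr01.
have := x1 k 0%N; rewrite xk tilt_add_absval_gt1//.
by rewrite leNgt z1.
Qed.

(** The ball of radius r^(p^n) around 0 in the tilt is the one where the n-th
    term is smaller than r. *)
Lemma tilt_cvg_near (x : nat -> nat -> C) (z : nat -> C) r n :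
    tilt p z -> (forall m, absval (z m) <= 1) -> tilt_cvg p x z ->
    absval (p%:R : C) <= r -> 0 < r < 1 ->
  \forall k \near \oo, absval (x k n - z n) <= r.
Proof.
move=> zt z1 xz pr /andP[r0 r1].
have := xz (r ^+ (p ^ n)); rewrite exprn_gt0// => /(_ isT).
apply: filterS => k [h [ht h0 ->]].
have hn : absval (h n) < r.
  rewrite -(@ltr_pXn2r _ (p ^ n)) ?expn_gt0 ?prime_gt0 ?nnegrE ?absval_ge0//.
    by rewrite -absvalX (tilt_iter n 0 ht).
  exact: ltW.
have h1 : absval (h 0%N) <= 1.
  by apply: le_trans (ltW h0) _; rewrite exprn_ile1 ?ltW.
have hc : frob_compatible (z \+ h).
  by apply: frob_compatibleD; apply: tilt_frob_compatible => //; exact: tilt_le1.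
apply: (absvalB_le_trans (le_trans (tilt_lift_congr hc n) pr)).
by rewrite /= addrC addKr ltW.
Qed.

(** Two limits agree within r at every stage n, hence are equal by
    [tilt_lift_unique]. *)
Lemma tilt_cvg_unique (x : nat -> nat -> C) (z z' : nat -> C) :
    (forall k n, absval (x k n) <= 1) -> tilt p z -> tilt p z' ->
  tilt_cvg p x z -> tilt_cvg p x z' -> z = z'.
Proof.
move=> x1 zt z't xz xz'.
have z1 := tilt_cvg_le1 zt x1 xz; have z'1 := tilt_cvg_le1 z't x1 xz'.
(* In characteristic p the absolute value of p is 0, but r must be positive. *)
pose r := Num.max (absval (p%:R : C)) 2^-1.
have r01 : 0 < r < 1.
  rewrite lt_max gt_max p_lt1 invr_gt0 ltr0n orbT/=.
  by rewrite invf_lt1 ?ltr0n// ltr1n.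
have pr : absval (p%:R : C) <= r by rewrite le_max lexx.
have z'z n : absval (z' n - z n) <= r.
  have [k []] : exists k, absval (x k n - z n) <= r /\ absval (x k n - z' n) <= r.
    have [N _ NH] : \forall k \near \oo,
        absval (x k n - z n) <= r /\ absval (x k n - z' n) <= r.
      by near do split; exact: tilt_cvg_near.
    by exists N; exact: NH (leqnn _).
  by move=> xkz xkz'; apply: absvalB_le_trans xkz; rewrite absvalBC.
case/andP: r01 => _ r1.
rewrite -(tilt_lift_unique r1 zt z1 z'1 z'z).
by apply: (tilt_lift_unique r1) => // n; rewrite subrr absval0 (le_trans (absval_ge0 (p%:R : C))).
Unshelve. all: by end_near. Qed.

End ResidueCharacteristic.

(** * The p-adic distance on Z[1/p] *)

Section PadicDistance.
Variable p : nat.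
Hypothesis p_prime : prime p.
Local Notation Hpp := (Hpp p).
Implicit Types a b : Hpp.

Let p_neq0 : (p%:R : rat) != 0.
Proof. by rewrite pnatr_eq0 -lt0n prime_gt0. Qed.

Lemma Hpp_valD a b : Hpp_val (a + b) = Hpp_val a + Hpp_val b.
Proof. by []. Qed.

Lemma Hpp_val_mulrn a m : Hpp_val (a *+ m) = Hpp_val a *+ m.
Proof. by elim: m => // m IH; rewrite !mulrS Hpp_valD IH. Qed.

Lemma Hpp_val_invp n : Hpp_val (Hpp_invp p n) = (p%:R ^+ n)^-1.
Proof. by rewrite /= mulr1 -exprnN. Qed.

Lemma Hpp_invp_mulrn n m : Hpp_invp p n = Hpp_invp p (n + m) *+ p ^ m.
Proof.
apply: val_inj; rewrite /= -[RHS]/(Hpp_val _) Hpp_val_mulrn -[LHS]/(Hpp_val (Hpp_invp p n)).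
rewrite !Hpp_val_invp -[RHS]mulr_natr natrX exprD invfM -mulrA mulVf ?mulr1//.
by rewrite expf_neq0.
Qed.

Lemma Hpp_frac a : exists nm : nat * nat, a = Hpp_invp p nm.1 *+ nm.2.
Proof.
have /andP[/= /ZinvpP[n an] a0] := Hpp_valP a.
have /natrP[m am] : p%:R ^+ n * Hpp_val a \is a Num.nat.
  by rewrite natrEint an/= mulr_ge0// exprn_ge0.
exists (n, m); apply: val_inj; rewrite -[RHS]/(Hpp_val _) Hpp_val_mulrn Hpp_val_invp.
by rewrite -[RHS]mulr_natr -am mulrA mulVf ?mul1r// expf_neq0.
Qed.

Lemma Hpp_scaleD k a b : Hpp_scale k (a + b) = Hpp_scale k a + Hpp_scale k b.
Proof. by apply: val_inj; rewrite /= -mulrDr. Qed.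

Lemma Hpp_scale0 k : Hpp_scale k (0 : Hpp) = 0.
Proof. by apply: val_inj; rewrite /= mulr0. Qed.

Lemma Hpp_scale_nat k a : Hpp_scale k%:Z a = a *+ p ^ k.
Proof.
apply: val_inj; rewrite -[RHS]/(Hpp_val _) Hpp_val_mulrn/= -[RHS]mulr_natr.
by rewrite natrX mulrC.
Qed.

Lemma Hpp_scale_negz k n : Hpp_scale (Negz k) (Hpp_invp p n) = Hpp_invp p (n + k.+1).
Proof.
apply: val_inj; rewrite -[RHS]/(Hpp_val _) Hpp_val_invp/= mulr1 NegzE -!exprnN.
by rewrite exprD invfM mulrC.
Qed.

(** The p-integral elements of Z[1/p] are the integers, so p-adic closeness in
    H_p^+ is an ordinary congruence. *)
Lemma padic_abs_small (c : rat) n : c \in Zinvp p ->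
  padic_abs p c <= p%:R ^- n -> exists m : int, c = p%:R ^+ n * m%:~R.
Proof.
move=> /ZinvpP[k ck].
have [->|c0] := eqVneq c 0; first by exists 0; rewrite mulr0.
have den_p : (`|denq c| %| p ^ k)%N.
  have /intrP[m cm] := ck.
  have : p%:R ^+ k * (numq c)%:~R = m%:~R * (denq c)%:~R :> rat.
    by rewrite -cm -[in RHS]mulrA -numqE.
  rewrite -natrX -[(p ^ k)%:R]/((p ^ k)%N%:Z%:~R) -!intrM => /intr_inj /(congr1 absz).
  rewrite !abszM/= => eq_m.
  have : (`|denq c| %| p ^ k * `|numq c|)%N by rewrite eq_m dvdn_mull.
  by rewrite Gauss_dvdl// coprime_sym coprime_num_den.
have /(dvdn_pfactor _ _ p_prime)[j _ den_j] := den_p.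
rewrite /padic_abs (negbTE c0) exprnN ler_eXz2l ?ltr1n ?prime_gt1// lerN2.
rewrite /padic_val den_j pfactorK// => val_n.
have num0 : (0 < `|numq c|)%N by rewrite absz_gt0 numq_eq0.
have j0 : j = 0%N.
  case: j den_j val_n => // j den_j val_n.
  have : coprime `|numq c| (p ^ j.+1) by rewrite -den_j coprime_num_den.
  rewrite coprime_pexpr// coprime_sym prime_coprime// => /negP.
  by move: val_n; rewrite -[p in (p %| _)%N]expn1 pfactor_dvdn//; lia.
move: val_n; rewrite j0 subr0 lez_nat -pfactor_dvdn// => dvd_n.
have /dvdzP[m num_m] : ((p ^ n)%N%:Z %| numq c)%Z by rewrite dvdzE.
exists m; rewrite -[LHS]divq_num_den num_m.
have -> : denq c = 1 by apply/eqP; rewrite -absz_denq den_j j0.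
by rewrite divr1 intrM mulrC -pmulrn natrX.
Qed.

Lemma padic_abs_expM (c : rat) n :
  padic_abs p (p%:R ^+ n * c) = p%:R ^- n * padic_abs p c.
Proof.
have [->|c0] := eqVneq c 0; first by rewrite mulr0 /padic_abs eqxx mulr0.
have pn0 : (p%:R : rat) ^+ n != 0 by rewrite expf_neq0.
rewrite /padic_abs mulf_eq0 (negbTE pn0) (negbTE c0)/=.
suff -> : padic_val p (p%:R ^+ n * c) = n%:Z + padic_val p c.
  by rewrite opprD expfzDr// exprnN.
have -> : p%:R ^+ n * c = ((p ^ n)%N%:Z * numq c)%:~R / (denq c)%:~R.
  by rewrite intrM -mulrA divq_num_den -pmulrn natrX.
have num0 : numq c != 0 by rewrite numq_eq0.
have ppn : (0 < p ^ n)%N by rewrite expn_gt0 prime_gt0.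
have pnz : (p ^ n)%N%:Z != 0 by rewrite eqz_nat -lt0n.
rewrite padic_val_frac ?denq_neq0 ?mulf_neq0//.
by rewrite abszM lognM ?absz_gt0// pfactorK// PoszD addrA.
Qed.

End PadicDistance.

(** * Points as characters with values in 1 + m *)

Section Points.
Variables (p : nat) (R : realType) (C : completeUltrametricFieldType R).
Hypothesis p_prime : prime p.
Hypothesis p_lt1 : absval (p%:R : C) < 1.
Local Notation Hpp := (Hpp p).
Implicit Types (a b : Hpp) (chi : Hpp -> C) (psi : Hp p -> C).

Section Character.
Variable chi : Hpp -> C.
Hypotheses (chi0 : chi 0 = 1) (chiD : forall a b, chi (a + b) = chi a * chi b).

Lemma character_mulrn a m : chi (a *+ m) = chi a ^+ m.
Proof. by elim: m => [|m IH]; rewrite ?mulr0n// mulrS exprS chiD IH. Qed.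

Lemma beta_tilt : tilt p (beta chi).
Proof.
by move=> n; rewrite /beta -character_mulrn (Hpp_invp_mulrn p_prime n 1) expn1 addn1.
Qed.

Lemma character_congr a b m (j : nat) : absval (chi b) <= 1 ->
    absval (chi (Hpp_invp p 0)) <= 1 ->
    Hpp_val a - Hpp_val b = p%:R ^+ m * j%:R ->
  absval (chi a - chi b) <= absval (chi (Hpp_invp p 0) ^+ (p ^ m) - 1).
Proof.
move=> b1 one1 ab; have -> : a = b + Hpp_invp p 0 *+ (p ^ m * j).
  apply: val_inj; rewrite -[RHS]/(Hpp_val _) Hpp_valD Hpp_val_mulrn.
  rewrite Hpp_val_invp expr0 invr1 -[LHS](subrK (Hpp_val b)) ab addrC.
  by rewrite natrM natrX.
rewrite chiD character_mulrn exprM -[X in _ - X]mulr1 -mulrBr absvalM.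
apply: le_trans (absvalX_sub1_le j _); last exact: absvalX_le1.
by rewrite ler_piMl ?absval_ge0.
Qed.

(** Arguments at p-adic distance at most p^-m differ by an integer multiple of
    p^m, and chi(1)^(p^m) tends to 1. *)
Lemma one_plus_character_continuous :
  (forall a, absval (chi a - 1) < 1) -> continuous chi.
Proof.
move=> chi1; have vchi a : absval (chi a) <= 1 by rewrite absval_one_plus.
move=> a; apply/(@cvgrPdist_lt R C Hpp (nbhs a)) => e e0.
have [r r01 rm] := one_plus_powers_geometric p_prime p_lt1 (chi1 (Hpp_invp p 0)).
have [m _ /(_ m (leqnn _)) rme] := geometric_lt r01 e0.
have {rme}me : absval (chi (Hpp_invp p 0) ^+ (p ^ m) - 1) < e.
  apply: le_lt_trans (rm m) (le_lt_trans _ rme); case/andP: r01 => r0 /ltW r1.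
  by rewrite exprS ler_piMl ?exprn_ge0.
apply/nbhs_ballP; exists (p%:R ^- m : rat) => [|b] /=.
  by rewrite invr_gt0 exprn_gt0// ltr0n prime_gt0.
rewrite ballEmdist /= -[mdist a b]/(padic_abs p (Hpp_val a - Hpp_val b)) => /ltW ab.
rewrite mdist_absval; apply: le_lt_trans me.
have [j abj] := padic_abs_small p_prime (rpredB (Hpp_in_Hp a) (Hpp_in_Hp b)) ab.
case: (intP j) abj => [|{}j|{}j] abj.
- exact: (@character_congr _ _ _ 0).
- exact: (@character_congr _ _ _ j.+1).
- rewrite absvalBC; apply: (@character_congr _ _ _ j.+1) => //.
  by rewrite -opprB abj mulrNz mulrN opprK.
Qed.

(** The sequence p^n a tends to 0 in H_p^+, so some chi(a)^(p^n) lies in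
    1 + m, and p-power roots of elements of 1 + m lie in 1 + m. *)
Lemma continuous_character_one_plus :
  continuous chi -> forall a, absval (chi a - 1) < 1.
Proof.
move=> chic a; have /cvgrPdist_lt/(_ 1 ltr01) := chic 0.
rewrite chi0 => /nbhs_ballP[/= e e0 eball].
pose n := Num.bound (padic_abs p (Hpp_val a) / e).
apply: (one_plus_root_iter p_prime p_lt1 (m := n)).
rewrite -character_mulrn absvalBC -mdist_absval; apply: eball.
rewrite ballEmdist/= -[mdist _ _]/(padic_abs p (0 - Hpp_val (a *+ p ^ n))).
rewrite sub0r padic_absN Hpp_val_mulrn -[Hpp_val a *+ _]mulr_natl natrX.
rewrite padic_abs_expM// mulrC ltr_pdivrMr ?exprn_gt0 ?ltr0n ?prime_gt0//.
rewrite mulrC -ltr_pdivrMr// (lt_trans (archi_boundP _))//.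
  by rewrite divr_ge0 ?padic_abs_ge0// ltW.
by rewrite -natrX ltr_nat ltn_expl// prime_gt1.
Qed.

End Character.

Lemma PtsP chi : Pts chi <->
  [/\ chi 0 = 1, (forall a b, chi (a + b) = chi a * chi b)
    & forall a, absval (chi a - 1) < 1].
Proof.
split=> -[chi0 chiD chi1]; split=> //.
  exact: continuous_character_one_plus.
exact: one_plus_character_continuous.
Qed.

(** * Characters of Z[1/p] *)

Lemma Hp_diff (c : Hp p) :
  exists ab : Hpp * Hpp, c = Hp_of_Hpp ab.1 - Hp_of_Hpp ab.2.
Proof.
have [c0|/ltW c0] := leP 0 (Hp_val c).
  have cZ : Hp_val c \in Zinvp_nneg p by apply/andP; split; first exact: Hp_valP.
  by exists (MkHpp cZ, 0); apply: val_inj; rewrite /= subr0.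
have cZ : - Hp_val c \in Zinvp_nneg p.
  have NcZ : - Hp_val c \in Zinvp p by rewrite rpredN Hp_valP.
  by apply/andP; split=> //; rewrite inE oppr_ge0.
by exists (0, MkHpp cZ); apply: val_inj; rewrite /= sub0r opprK.
Qed.

Lemma Hp_of_HppD a b : Hp_of_Hpp (a + b) = Hp_of_Hpp a + Hp_of_Hpp b.
Proof. exact: val_inj. Qed.

Lemma Hom_Hp_diff psi : Hom_Hp psi -> forall a b,
  psi (Hp_of_Hpp a - Hp_of_Hpp b) = restrict_Hpp psi a / restrict_Hpp psi b.
Proof.
move=> [psi1 psiD] a b; apply: canRL (mulfK _) _; last first.
  by rewrite /restrict_Hpp -psiD subrK.
by rewrite -absval_eq0 absval_one_plus ?oner_eq0//; exact/one_plus_maxidealE/psi1.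
Qed.

Lemma restrict_Hpp_Pts psi : Hom_Hp psi -> Pts (restrict_Hpp psi).
Proof.
move=> [psi1 psiD]; apply/PtsP; split=> [|a b|a].
- rewrite /restrict_Hpp (_ : Hp_of_Hpp _ = 0); last exact: val_inj.
  have psi0 : psi 0 != 0.
    by rewrite -absval_eq0 absval_one_plus ?oner_eq0//; exact/one_plus_maxidealE/psi1.
  by apply: (mulfI psi0); rewrite -psiD addr0 mulr1.
- by rewrite /restrict_Hpp Hp_of_HppD psiD.
- exact/one_plus_maxidealE/psi1.
Qed.

Lemma restrict_Hpp_inj psi psi' : Hom_Hp psi -> Hom_Hp psi' ->
  restrict_Hpp psi = restrict_Hpp psi' -> psi = psi'.
Proof.
move=> hpsi hpsi' eq_psi; apply/funext => c; have [[a b] ->] := Hp_diff c.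
by rewrite !Hom_Hp_diff// eq_psi.
Qed.

(** The extension sends a - b to chi(a) / chi(b). *)
Lemma restrict_Hpp_surj chi : Pts chi ->
  exists2 psi, Hom_Hp psi & restrict_Hpp psi = chi.
Proof.
move=> /PtsP[chi0 chiD chi1].
have chi_neq0 a : chi a != 0 by rewrite -absval_eq0 absval_one_plus ?oner_eq0.
pose ab c := projT1 (cid (Hp_diff c)).
pose psi c := chi (ab c).1 / chi (ab c).2.
have psiE a b : psi (Hp_of_Hpp a - Hp_of_Hpp b) = chi a / chi b.
  rewrite /psi /ab; case: cid => -[a' b'] /= /(congr1 (@Hp_val p)) /= e.
  apply/eqP; rewrite eqr_div// -!chiD; apply/eqP; congr chi; apply: val_inj => /=.
  by lra.
exists psi; last first.
  apply/funext => a; rewrite /restrict_Hpp -[RHS]divr1 -chi0 -psiE; congr psi.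
  by apply: val_inj; rewrite /= subr0.
split=> [c|c d].
  apply/one_plus_maxidealE; have [[a b] ->] := Hp_diff c.
  by rewrite psiE one_plusM ?one_plusV.
have [[a b] ->] := Hp_diff c; have [[a' b'] ->] := Hp_diff d.
rewrite /= addrACA -opprD -!Hp_of_HppD !psiE !chiD invfM.
by rewrite mulrACA.
Qed.

(** * Characters of the nonnegative cone and the tilt *)

Lemma beta_mulrn chi n m : Pts chi -> chi (Hpp_invp p n *+ m) = beta chi n ^+ m.
Proof. by move=> /PtsP[chi0 chiD _]; rewrite character_mulrn. Qed.

Lemma beta_in chi : Pts chi -> one_plus_tilt_maxideal p C (beta chi).
Proof.
move=> /PtsP[chi0 chiD chi1]; apply/one_plus_tilt_maxidealE => //.
by split=> [|n]; [exact: beta_tilt|exact: chi1].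
Qed.

Lemma beta_inj chi chi' : Pts chi -> Pts chi' -> beta chi = beta chi' -> chi = chi'.
Proof.
move=> cP c'P eq_beta; apply/funext => a; have [[n m] ->] := Hpp_frac p_prime a.
by rewrite !beta_mulrn// eq_beta.
Qed.

(** The character sends m / p^n to x_n^m, which does not depend on the way the
    fraction is written since x is a system of p-power roots. *)
Lemma beta_surj (x : nat -> C) : one_plus_tilt_maxideal p C x ->
  exists2 chi : Hpp -> C, Pts chi & beta chi = x.
Proof.
move=> /(one_plus_tilt_maxidealE p_prime p_lt1)[xt x1].
pose nm a := projT1 (cid (Hpp_frac p_prime a)).
pose chi a := x (nm a).1 ^+ (nm a).2.
have xn n k m : x n ^+ m = x (n + k)%N ^+ (p ^ k * m).
  by rewrite exprM tilt_iter.
have invpE n k m : Hpp_invp p n *+ m = Hpp_invp p (n + k) *+ (p ^ k * m).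
  by rewrite (Hpp_invp_mulrn p_prime n k) -mulrnA.
have chiE n m : chi (Hpp_invp p n *+ m) = x n ^+ m.
  rewrite /chi /nm; case: cid => -[n' m'] /=.
  rewrite (invpE n n') (invpE n' n) [(n' + n)%N]addnC.
  move=> /(congr1 (@Hpp_val p)); rewrite !Hpp_val_mulrn Hpp_val_invp//.
  move=> /(mulrIn _) eq_m; rewrite (xn n n') (xn n' n) [(n' + n)%N]addnC eq_m//.
  by rewrite invr_eq0 expf_neq0// pnatr_eq0 -lt0n prime_gt0.
have chi0 : chi 0 = 1 by rewrite -[0](mulr0n (Hpp_invp p 0)) chiE expr0.
exists chi; last by apply/funext => n; rewrite /beta -[Hpp_invp p n]mulr1n chiE.
apply/PtsP; split=> // [a b|a].
  have [[n m] ->] := Hpp_frac p_prime a; have [[n' m'] ->] := Hpp_frac p_prime b.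
  rewrite (invpE n n') (invpE n' n) [(n' + n)%N]addnC -mulrnDr !chiE.
  by rewrite exprD.
have [[n m] ->] := Hpp_frac p_prime a.
by rewrite chiE one_plusX.
Qed.

(** * Exponentiation by p-adic integers *)

Implicit Types (u : padic_int p) (x y : C).

(** Since u_(k+1) = u_k mod p^k, consecutive powers differ by a factor that is
    a power of x^(p^k). *)
Lemma zp_pow_cvg x u : absval (x - 1) < 1 ->
  (fun k => x ^+ u k) @ \oo --> zp_pow x u.
Proof.
move=> x1; have vx := absval_one_plus x1.
have /cvg_ex[l xl] : cvg ((fun k => x ^+ u k) @ \oo).
  have [r r01 rm] := one_plus_powers_geometric p_prime p_lt1 x1.
  apply: (cvg_geometric_step r01) => k.
  rewrite (divn_eq (u k.+1) (p ^ k)) padic_resP exprD -[X in _ - X]mul1r -mulrBl.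
  rewrite absvalM absvalX vx expr1n mulr1 mulnC exprM.
  apply: le_trans (absvalX_sub1_le _ _) (le_trans (rm k) _).
    by rewrite absvalX vx expr1n.
  by case/andP: r01 => r0 /ltW r1; rewrite exprS ler_piMl ?exprn_ge0.
by rewrite /zp_pow (cvg_lim_absval xl).
Qed.

Lemma zp_pow_one u : zp_pow (1 : C) u = 1.
Proof.
apply: cvg_lim_absval; under eq_cvg do rewrite expr1n.
exact: cvg_cst.
Qed.

Lemma zp_powM x y u : absval (x - 1) < 1 -> absval (y - 1) < 1 ->
  zp_pow (x * y) u = zp_pow x u * zp_pow y u.
Proof.
move=> x1 y1; apply: cvg_lim_absval.
apply: cvg_trans (cvg_mul (zp_pow_cvg (u := u) x1) (zp_pow_cvg (u := u) y1)).
by apply: near_eq_cvg; apply: nearW => k; rewrite exprMn.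
Qed.

Lemma zp_powX x u n : absval (x - 1) < 1 -> zp_pow (x ^+ n) u = zp_pow x u ^+ n.
Proof.
move=> x1; elim: n => [|n IH]; first by rewrite !expr0 zp_pow_one.
by rewrite !exprS zp_powM ?IH// one_plusX.
Qed.

Lemma zp_pow_one_plus x u : absval (x - 1) < 1 -> absval (zp_pow x u - 1) < 1.
Proof.
move=> x1; apply: le_lt_trans (x1).
apply: cvg_absval_le (zp_pow_cvg (u := u) x1) _ => k.
by apply: absvalX_sub1_le; rewrite absval_one_plus.
Qed.

(** Convergence at every stage gives convergence in the tilt, where limits are
    unique. *)
Lemma tilt_zp_powE (x : nat -> C) u :
    tilt p x -> (forall n, absval (x n - 1) < 1) ->
  tilt_zp_pow x u = (fun n => zp_pow (x n) u).
Proof.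
move=> xt x1; set z := fun n => _.
have zt : tilt p z by move=> n; rewrite /z -zp_powX// xt.
have xut k : tilt p (tilt_exp x (u k)).
  by move=> n; rewrite /tilt_exp exprAC xt.
have xu1 k n : absval (tilt_exp x (u k) n) <= 1.
  by rewrite absval_one_plus// one_plusX.
have z1 n : absval (z n) <= 1 by rewrite absval_one_plus// zp_pow_one_plus.
have xz : tilt_cvg p (fun k => tilt_exp x (u k)) z.
  by apply: tilt_cvg_pointwise => // n; exact: zp_pow_cvg.
apply: get_unique => // z' [z't xz'].
exact: (tilt_cvg_unique p_prime p_lt1 xu1).
Qed.

Lemma frobz_beta (k : int) chi : Pts chi ->
  frobz p k (beta chi) = beta (fun a => chi (Hpp_scale k a)).
Proof.
move=> cP; apply/funext => n; case: k => k /=.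
  have -> : iter k (@frob p R C) (beta chi) n = beta chi n ^+ (p ^ k).
    elim: k n => [|k IH] n; first by rewrite expn0 expr1.
    by rewrite /= /frob /tilt_exp IH expnSr exprM.
  by rewrite -beta_mulrn// /beta Hpp_scale_nat.
rewrite /beta Hpp_scale_negz.
have iterE j m : iter j (@frob_inv R C) (beta chi) m = beta chi (m + j)%N.
  by elim: j m => [|j IH] m; rewrite ?addn0//= /frob_inv IH addSnnS.
by rewrite /frob_inv iterE addSnnS.
Qed.

Lemma act_PtsP (g : Qp_units p) chi : Pts chi ->
  Pts (act_Pts g chi) /\ beta (act_Pts g chi) = act_tilt g (beta chi).
Proof.
case: g => k u cP; have /PtsP[chi0 chiD chi1] := cP.
have dP : Pts (fun a => chi (Hpp_scale k a)).
  by apply/PtsP; split=> [|a b|a]; rewrite ?Hpp_scale0 ?Hpp_scaleD.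
split.
  apply/PtsP; rewrite /act_Pts; split=> [|a b|a]/=.
  - by rewrite Hpp_scale0 chi0 zp_pow_one.
  - by rewrite Hpp_scaleD chiD zp_powM.
  - exact: zp_pow_one_plus.
rewrite /act_tilt/= frobz_beta//.
have [xt x1] := (one_plus_tilt_maxidealE p_prime p_lt1 _).1 (beta_in dP).
by rewrite tilt_zp_powE.
Qed.

End Points.

(** * Bijectivity and equivariance *)

Theorem theorem3p9 (p : nat) (R : realType)
    (C : completeUltrametricFieldType R)
    (p_prime : prime p) (C_perfectoid : perfectoid C p) :
  [/\ set_bij (@Hom_Hp p R C) (@Pts p R C) (@restrict_Hpp p R C),
      set_bij (@Pts p R C) (one_plus_tilt_maxideal p C) (@beta p R C)
    & forall (g : Qp_units p) (chi : Hpp p -> C), Pts chi ->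
        Pts (act_Pts g chi) /\ beta (act_Pts g chi) = act_tilt g (beta chi)].
Proof.
have [p_lt1 _ _] := C_perfectoid; split.
- split=> [psi|psi psi'|chi].
  + exact: restrict_Hpp_Pts.
  + by rewrite !inE; exact: restrict_Hpp_inj.
  + exact: restrict_Hpp_surj.
- split=> [chi|chi chi'|x].
  + exact: beta_in.
  + by rewrite !inE; exact: beta_inj.
  + exact: beta_surj.
- by move=> g chi; exact: act_PtsP.
Qed.
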